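(* (Lagrange's Theorem for L-subgyrogroups) Let $G$ be a finite gyrogroup. If $H$ is an L-subgyrogroup of $G$, then $|H|$ divides $|G|$.
   Context: A gyrogroup is a nonempty set $G$ with a binary operation $\oplus$ such that: (G1) there is $0\in G$ with $0\oplus a=a$ for all $a$; (G2) for each $a$ there is $b$ with $b\oplus a=0$; (G3) for all $a,b\in G$ there is an automorphism $\mathrm{gyr}[a,b]$ of $(G,\oplus)$ (a bijection $G\to G$ preserving $\oplus$) with $a\oplus(b\oplus c)=(a\oplus b)\oplus\mathrm{gyr}[a,b]c$ for all $c\in G$; (G4) $\mathrm{gyr}[a,b]=\mathrm{gyr}[a\oplus b,b]$ for all $a,b\in G$. It is known that $0$ is a two-sided identity, every $a$ has a two-sided inverse $\ominus a$, and $\mathrm{gyr}[a,b]c=\ominus(a\oplus b)\oplus(a\oplus(b\oplus c))$. A nonempty subset $H$ of $G$ is a subgyrogroup if $H$ is a gyrogroup under the operation inherited from $G$ and, for all $a,b\in H$, the restriction of $\mathrm{gyr}[a,b]$ to $H$ is an automorphism of $H$. A subgyrogroup $H$ of $G$ is an L-subgyrogroup if $\mathrm{gyr}[a,h](H)=H$ for all $a\in G$ and $h\in H$. *)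

(* Defs.v *)
From mathcomp Require Import all_boot.

Set Implicit Arguments.
Unset Strict Implicit.
Unset Printing Implicit Defensive.

Definition automorphism (T : Type) (op : T -> T -> T) (f : T -> T) : Prop :=
  bijective f /\ {morph f : x y / op x y}.

(* The gyrator is a field of the structure. This adds no information beyond
   "for all a, b there is an automorphism gyr[a,b]": the other axioms give
   left cancellation, so the operation determines it. *)
Record gyrogroup (T : Type) := Gyrogroup {
  gadd : T -> T -> T;
  gzero : T;
  gyr : T -> T -> T -> T;
  gadd0g : forall a, gadd gzero a = a;
  gaddNg : forall a, exists b, gadd b a = gzero;
  gyr_aut : forall a b, automorphism gadd (gyr a b);
  gaddA : forall a b c, gadd a (gadd b c) = gadd (gadd a b) (gyr a b c);
  gyr_loop : forall a b, gyr a b =1 gyr (gadd a b) b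
}.

(* The gyrogroup K lives on the subtype of elements of H. Requiring val to
   preserve the operation says that H is closed under the operation of g and
   that K carries the inherited one. The last clause is about the gyrator of g,
   not the one of K: s is its restriction to H. *)
Definition subgyrogroup (G : finType) (g : gyrogroup G) (H : {set G}) : Prop :=
  H != set0 /\
  exists K : gyrogroup {x : G | x \in H},
    (forall x y, val (gadd K x y) = gadd g (val x) (val y)) /\
    (forall a b, a \in H -> b \in H ->
      exists s : {x : G | x \in H} -> {x : G | x \in H},
        (forall x, val (s x) = gyr g a b (val x)) /\
        automorphism (gadd K) s).

Definition Lsubgyrogroup (G : finType) (g : gyrogroup G) (H : {set G}) : Prop :=
  subgyrogroup g H /\
  forall a h, h \in H -> [set gyr g a h x | x in H] = H.

(* Main.v *)
Require Import Defs.
From mathcomp Require Import all_boot.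

(** As for groups, the left cosets of [H] partition [G] into blocks of size
    [#|H|]. Left translations are injective because the loop property makes
    [gyr b a] trivial whenever [b] is a left inverse of [a]; this gives the
    common size ([card_gcoset]). Disjointness of distinct cosets is where the
    missing associativity has to be repaired: associating [a + (h + x)] to the
    left twists [x] by [gyr a h], and the L-condition says that this twist only
    permutes [H], so that [(a + h) + H = a + (h + H) = a + H]
    ([gcosetD]). *)

Section Gyrogroup.
Context {T : Type} (g : gyrogroup T).
Local Notation "a + b" := (gadd g a b).
Local Notation "0" := (gzero g).

(** The loop property identifies [gyr b a] with [gyr (b + a) a = gyr 0 a], and
    associating [0 + (a + c)] gives [a + c = a + gyr 0 a c]. Cancellation on the
    left is not known yet, but adding [b] to both sides turns this into an
    equality between values of the injective map [gyr b a]. *)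
Lemma gyr_leftinv a b : b + a = 0 -> gyr g b a =1 id.
Proof.
move=> ba0 c; rewrite gyr_loop ba0.
have gyr0 : a + gyr g 0 a c = a + c.
  by rewrite -{1}[a](gadd0g g) -gaddA gadd0g.
have [/bij_inj gyr_inj _] := gyr_aut g b a.
have addb x : b + (a + x) = gyr g b a x by rewrite gaddA ba0 gadd0g.
by apply: gyr_inj; rewrite -!addb gyr0.
Qed.

Lemma gaddKg a b : b + a = 0 -> cancel (gadd g a) (gadd g b).
Proof. by move=> ba0 c; rewrite gaddA ba0 gadd0g gyr_leftinv. Qed.

Lemma gaddgI a : injective (gadd g a).
Proof. by have [b ba0] := gaddNg g a; apply: can_inj (gaddKg a b ba0). Qed.

(** Any left inverse [b] of [a] sends both sides to [0]. *)
Lemma gaddg0 a : a + 0 = a.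
Proof.
have [b ba0] := gaddNg g a.
by apply: (gaddgI b); rewrite gaddKg.
Qed.

End Gyrogroup.

Lemma subgyrogroup_closed (G : finType) (g : gyrogroup G) (H : {set G}) :
  subgyrogroup g H -> {in H &, forall x y, gadd g x y \in H}.
Proof.
move=> [_ [K [valD _]]] x y xH yH.
by rewrite -[x]/(val (exist _ x xH)) -[y]/(val (exist _ y yH)) -valD; apply: valP.
Qed.

Definition gcoset {G : finType} (g : gyrogroup G) (H : {set G}) a :=
  [set gadd g a x | x in H].

Section Cosets.
Context {G : finType} (g : gyrogroup G) (H : {set G}).
Local Notation "a + b" := (gadd g a b).
Local Notation "0" := (gzero g).

Lemma card_gcoset a : #|gcoset g H a| = #|H|.
Proof. exact/card_imset/gaddgI. Qed.

Hypothesis HD : {in H &, forall x y, x + y \in H}.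

(** Finiteness replaces inverses: an injective self-map of [H] is onto. *)
Lemma gcoset_id h : h \in H -> gcoset g H h = H.
Proof.
move=> hH; apply/eqP; rewrite eqEcard card_gcoset leqnn andbT.
by apply/subsetP => _ /imsetP[x xH ->]; apply: HD.
Qed.

(** Some [x] in [H] solves [h + x = h], and cancellation forces it to be [0]. *)
Lemma mem_gzero : H != set0 -> 0 \in H.
Proof.
case/set0Pn => h hH; have := hH; rewrite -{1}(gcoset_id h hH).
case/imsetP => x xH hE; suff -> : 0 = x by [].
by apply: (gaddgI g h); rewrite gaddg0.
Qed.

Hypothesis gyrH : forall a h, h \in H -> [set gyr g a h x | x in H] = H.

Lemma gcosetD a h : h \in H -> gcoset g H (a + h) = gcoset g H a.
Proof.
move=> hH.
transitivity (gcoset g [set gyr g a h x | x in H] (a + h)).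
  by rewrite gyrH.
transitivity (gcoset g (gcoset g H h) a); last by rewrite gcoset_id.
rewrite /gcoset -!imset_comp.
by apply: eq_imset => x /=; rewrite gaddA.
Qed.

Lemma gcoset_eqE a b : H != set0 ->
  (gcoset g H a == gcoset g H b) = (b \in gcoset g H a).
Proof.
move=> H_n0; apply/eqP/idP => [->|/imsetP[h hH ->]]; last by rewrite gcosetD.
by apply/imsetP; exists 0; rewrite ?gaddg0 ?mem_gzero.
Qed.

End Cosets.

Theorem theorem4p8 (G : finType) (g : gyrogroup G) (H : {set G}) :
  Lsubgyrogroup g H -> #|H| %| #|G|.
Proof.
move=> [subH gyrH]; have [H_n0 _] := subH.
have HD := subgyrogroup_closed G g H subH.
pose P := preim_partition (gcoset g H) [set: G].
have sizeP : {in P, forall A : {set G}, #|A| = #|H|}.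
  move=> _ /imsetP[a _ ->]; rewrite -(card_gcoset g H a).
  by apply: eq_card => b; rewrite !inE gcoset_eqE.
rewrite -cardsT (card_uniform_partition sizeP (preim_partitionP _ _)).
exact: dvdn_mull.
Qed.
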